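(* Let $(X,Y)$ be a pair of real random variables with marginal distribution functions $F$ (of $X$) and $G$ (of $Y$), and write $\bar F=1-F$, $\bar G=1-G$. Assume: (1) $\sup\{x: F(x)<1\}=\infty$, and $F\in MDA(\Lambda)$ with auxiliary function $f$; (2) $\lim_{x\to\infty}\bar G(x)/\bar F(x)=c$ for some $c\in[0,\infty)$; (3) for all $t>0$, $\lim_{x\to\infty}P(|Y|>t f(x)\mid X>x)=0$; (4) for all $t>0$, $\lim_{x\to\infty}P(|X|>t f(x)\mid Y>x)=0$; (5) for some $L>0$, $\lim_{x\to\infty}\dfrac{P(Y>Lf(x),\,X>Lf(x))}{P(X>x)}=0$. Then $$P(X+Y>x)\sim(1+c)\,P(X>x),\qquad x\to\infty,$$ i.e. $\lim_{x\to\infty}\dfrac{P(X+Y>x)}{P(X>x)}=1+c$.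
   Context: $MDA(\Lambda)$ is the maximal domain of attraction of the Gumbel distribution $\Lambda(x)=\exp\{-e^{-x}\}$: the class of distribution functions $F$ for which there exist $a_n>0$, $b_n\in\mathbb{R}$ with $\lim_{n\to\infty}n\bar F(a_nx+b_n)=e^{-x}$ for all $x\in\mathbb{R}$, where $\bar F=1-F$. When $F$ has infinite right endpoint, $F\in MDA(\Lambda)$ is equivalent to the existence of an auxiliary function $f$: a positive function with derivative converging to $0$ at infinity, self-neglecting (i.e. $\lim_{t\to\infty}f(t+xf(t))/f(t)=1$ for all $x\in\mathbb{R}$), such that $\lim_{t\to\infty}\bar F(t+xf(t))/\bar F(t)=e^{-x}$ for all $x\in\mathbb{R}$. The function $f$ in the claim is such an auxiliary function of $F$. *)

(* Defs.v *)
From HB Require Import structures.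
From mathcomp Require Import all_boot all_order all_algebra.
From mathcomp Require Import all_classical all_reals all_analysis.

Set Implicit Arguments.
Unset Strict Implicit.
Unset Printing Implicit Defensive.

Import Order.TTheory GRing.Theory Num.Theory.
Import numFieldNormedType.Exports.

Local Open Scope classical_set_scope.
Local Open Scope ring_scope.

Definition prob d (T : measurableType d) (R : realType) (P : probability T R)
  (A : set T) : R := fine (P A).

(* P(A | B); since x / 0 = 0, this is 0 when P(B) = 0. *)
Definition cond_prob d (T : measurableType d) (R : realType)
  (P : probability T R) (A B : set T) : R := prob P (A `&` B) / prob P B.

Definition distr_fun d (T : measurableType d) (R : realType)
  (P : probability T R) (X : {RV P >-> R}) : R -> R := fun x => fine (cdf X x).

Definition is_distribution_function (R : realType) (F : R -> R) : Prop :=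
  [/\ {homo F : x y / x <= y}, right_continuous F,
      F x @[x --> -oo] --> (0 : R) & F x @[x --> +oo] --> (1 : R)].

Definition tail (R : realType) (F : R -> R) : R -> R := fun x => 1 - F x.

Definition right_endpoint (R : realType) (F : R -> R) : \bar R :=
  ereal_sup [set x%:E | x in [set x | F x < 1]].

Definition MDA_gumbel (R : realType) (F : R -> R) : Prop :=
  is_distribution_function F /\
  exists a b : nat -> R,
    (forall n, 0 < a n) /\
    (forall x : R, n%:R * tail F (a n * x + b n) @[n --> \oo] --> expR (- x)).

Definition self_neglecting (R : realType) (f : R -> R) : Prop :=
  forall x : R, f (t + x * f t) / f t @[t --> +oo] --> (1 : R).

(* Auxiliary functions matter only near +oo (they may be given only on some
   half-line ]x0, +oo[), so f is a total function whose positivity and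
   differentiability are required only on a neighbourhood of +oo. *)
Definition auxiliary_function (R : realType) (F f : R -> R) : Prop :=
  [/\ \forall t \near +oo, 0 < f t,
      \forall t \near +oo, derivable f t 1,
      derive1 f t @[t --> +oo] --> (0 : R),
      self_neglecting f
    & forall x : R,
        tail F (t + x * f t) / tail F t @[t --> +oo] --> expR (- x)].

(* Main.v *)
(* For s > 0 and every L, the event X + Y > x is contained in the union of
     X > x - s f(x),                    Y > x - s f(x),
     |Y| > s f(x) and X > x - L f(x),   |X| > s f(x) and Y > x - L f(x),
     X > L f(x) and Y > L f(x).
   Relative to P(X > x), the first two have probabilities tending to e^s and
   c e^s, and the other three are negligible.  For x >= 0 it contains the
   disjoint events (X > x + s f(x), |Y| <= s f(x)) and
   (Y > x + s f(x), |X| <= s f(x)), whose relative probabilities tend to e^-s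
   and c e^-s.  Letting s tend to 0 gives the limit 1 + c. *)
Require Import Defs.
From mathcomp Require Import all_boot all_order all_algebra.
From mathcomp Require Import all_classical all_reals all_analysis.
From mathcomp Require Import ring lra.

Set Implicit Arguments.
Unset Strict Implicit.
Unset Printing Implicit Defensive.

Import Order.TTheory GRing.Theory Num.Theory.
Import numFieldNormedType.Exports.

Local Open Scope classical_set_scope.
Local Open Scope ring_scope.

(** * Limit criteria for real functions along a filter *)

(** No uniformity in [s] is required: for a given tolerance, continuity of [k] at 0 supplies one
    fixed [s] with both [k s] and [k (- s)] within half of it of [k 0], and the bounds for that [s]
    alone suffice. *)
Lemma cvg_sandwich (R : realType) (F : set_system R) {FF : ProperFilter F}
    (g k : R -> R) :
    {for 0, continuous k} ->
    (forall s, 0 < s -> exists lo hi : R -> R,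
      [/\ \forall x \near F, lo x <= g x <= hi x,
          lo x @[x --> F] --> k s & hi x @[x --> F] --> k (- s)]) ->
  g x @[x --> F] --> k 0.
Proof.
move=> kc H; apply/cvgrPdist_le => e e0.
have [d /= d0 kd] : exists2 d, 0 < d & forall s, `|s| < d -> `|k 0 - k s| < e / 2.
  have e20 : 0 < e / 2 by rewrite divr_gt0.
  move/cvgrPdist_lt : kc => /(_ _ e20) /nbhs_ballP [d /= d0 kd].
  exists d => // s sd; apply: kd; rewrite /ball /= sub0r normrN//.
have d20 : 0 < d / 2 by rewrite divr_gt0.
have d2d : d / 2 < d by lra.
have [lo [hi [gb lol hil]]] := H _ d20.
have ks : `|k 0 - k (d / 2)| < e / 2 by apply: kd; rewrite gtr0_norm.
have kNs : `|k 0 - k (- (d / 2))| < e / 2 by apply: kd; rewrite normrN gtr0_norm.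
move: ks kNs; rewrite !ltr_norml => /andP[_ ks] /andP[kNs _].
near=> x.
have /andP[glo ghi] : lo x <= g x <= hi x by near: x.
have lox : k 0 - e < lo x by near: x; apply: (cvgr_gt _ lol); lra.
have hix : hi x < k 0 + e by near: x; apply: (cvgr_lt _ hil); lra.
by rewrite ler_norml; apply/andP; split; lra.
Unshelve. all: by end_near. Qed.

(** If [u x <= A], monotonicity gives [p (u x) >= p A > 0], which eventually fails. Applied with [p]
    the tail of [X]. *)
Lemma cvgy_of_cvg0 (R : realType) (F : set_system R) {FF : Filter F}
    (p u : R -> R) :
    (forall x, 0 < p x) -> {homo p : x y / x <= y >-> y <= x} ->
  p (u x) @[x --> F] --> 0 -> u x @[x --> F] --> +oo.
Proof.
move=> p0 pd pu; apply/cvgryPgt => A.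
apply: filterS (cvgr_lt _ pu _ (p0 A)) => x; apply: contraTT.
by rewrite -!leNgt => /pd.
Qed.

(** * Real-valued probabilities and tails *)

Section tail_probabilities.
Context d (T : measurableType d) (R : realType) (P : probability T R).

Lemma prob_EFin (A : set T) : measurable A -> P A = (prob P A)%:E.
Proof. by move=> mA; rewrite /prob fineK// fin_num_measure. Qed.

Lemma prob_ge0 (A : set T) : 0 <= prob P A.
Proof. by rewrite /prob fine_ge0. Qed.

Lemma le_prob (A B : set T) :
  measurable A -> measurable B -> A `<=` B -> prob P A <= prob P B.
Proof.
by move=> mA mB AB; rewrite -lee_fin -!prob_EFin// le_measure// inE.
Qed.

Lemma prob_setU_le (A B : set T) :
  measurable A -> measurable B -> prob P (A `|` B) <= prob P A + prob P B.
Proof.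
move=> mA mB; rewrite -lee_fin EFinD -!prob_EFin//; last exact: measurableU.
exact: measureU2.
Qed.

Lemma prob_setU (A B : set T) :
  measurable A -> measurable B -> A `&` B = set0 ->
  prob P (A `|` B) = prob P A + prob P B.
Proof.
move=> mA mB AB; apply: EFin_inj; rewrite EFinD -!prob_EFin//.
  exact: measureU.
exact: measurableU.
Qed.

Lemma prob_setD (A B : set T) :
  measurable A -> measurable B ->
  prob P (A `\` B) = prob P A - prob P (B `&` A).
Proof.
move=> mA mB; apply: EFin_inj; rewrite EFinB setIC -!prob_EFin//.
- by rewrite measureD// ltey_eq fin_num_measure.
- exact: measurableI.
- exact: measurableD.
Qed.

(* Also valid when P(B) = 0, where the conditional probability is junk. *)
Lemma cond_probM (A B : set T) :
  measurable A -> measurable B ->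
  cond_prob P A B * prob P B = prob P (A `&` B).
Proof.
move=> mA mB; rewrite /cond_prob.
have [B0|B0] := eqVneq (prob P B) 0; last by rewrite divfK.
rewrite B0 mulr0; apply/esym/eqP; rewrite eq_le prob_ge0 andbT -B0.
by apply: le_prob => //; exact: measurableI.
Qed.

Lemma measurable_gt (h : T -> R) (a : R) :
  measurable_fun setT h -> measurable [set w | a < h w].
Proof.
move=> mh; have -> : [set w | a < h w] = h @^-1` `]a, +oo[.
  by apply/seteqP; split => w /=; rewrite in_itv/= andbT.
by rewrite -[X in measurable X]setTI; exact: mh.
Qed.

Lemma measurable_norm_gt (h : T -> R) (a : R) :
  measurable_fun setT h -> measurable [set w | a < `|h w|].
Proof.
by move=> mh; apply: measurable_gt; apply: measurableT_comp.
Qed.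

Lemma prob_gt (X : {RV P >-> R}) (x : R) :
  prob P [set w | x < X w] = tail (distr_fun X) x.
Proof.
have mX : measurable (X @^-1` `]-oo, x]).
  by rewrite -[X in measurable X]setTI; exact: measurable_funP.
rewrite /tail /distr_fun /cdf /distribution /pushforward.
have -> : [set w | x < X w] = ~` (X @^-1` `]-oo, x]).
  by apply/seteqP; split => w /=; rewrite in_itv/= ltNge => /negP.
apply: EFin_inj; rewrite -prob_EFin; last exact: measurableC.
by rewrite probability_setC// EFinB prob_EFin.
Qed.

Lemma tail_distr_noninc (X : {RV P >-> R}) :
  {homo tail (distr_fun X) : x y / x <= y >-> y <= x}.
Proof.
move=> x y xy; rewrite -!prob_gt; apply: le_prob.
- exact/measurable_gt.
- exact/measurable_gt.
- by move=> w /=; exact: le_lt_trans.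
Qed.

(** This makes division by the tail of [X] legitimate at every point: a nonpositive value at [x]
    would persist to the right by monotonicity and bound the endpoint by [x]. *)
Lemma tail_distr_gt0 (X : {RV P >-> R}) (x : R) :
  right_endpoint (distr_fun X) = +oo%E -> 0 < tail (distr_fun X) x.
Proof.
move=> Xoo; rewrite ltNge; apply/negP => Fx.
suff : (right_endpoint (distr_fun X) <= x%:E)%E by rewrite Xoo leNgt ltry.
apply: ge_ereal_sup => _ [y /= Fy <-]; rewrite lee_fin leNgt; apply/negP => xy.
by have := tail_distr_noninc X (ltW xy); rewrite /tail in Fx *; lra.
Qed.

(** * Bounds on the probability of a large sum, for fixed thresholds *)

(** If neither variable exceeds [x - e], a sum above [x] forces both above [e]. Then either one of
    them exceeds [x - l], giving a cross event, or neither does and both exceed [l]. *)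
Lemma prob_sum_gt_le (X Y : {RV P >-> R}) (x e l : R) :
  prob P [set w | x < X w + Y w] <=
    prob P [set w | x - e < X w] + prob P [set w | x - e < Y w]
    + prob P ([set w | e < `|Y w|] `&` [set w | x - l < X w])
    + prob P ([set w | e < `|X w|] `&` [set w | x - l < Y w])
    + prob P [set w | l < Y w /\ l < X w].
Proof.
have mX a := measurable_gt a (measurable_funPT X).
have mY a := measurable_gt a (measurable_funPT Y).
have mYX := measurableI _ _ (measurable_norm_gt e (measurable_funPT Y)) (mX (x - l)).
have mXY := measurableI _ _ (measurable_norm_gt e (measurable_funPT X)) (mY (x - l)).
have mI : measurable [set w | l < Y w /\ l < X w] by exact: measurableI (mY l) (mX l).
have m2 := measurableU _ _ (mX (x - e)) (mY (x - e)).
have m3 := measurableU _ _ m2 mYX.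
have m4 := measurableU _ _ m3 mXY.
apply: le_trans (_ : _ <= prob P (_ `|` _)) _; last first.
  apply: le_trans (prob_setU_le m4 mI) _; rewrite lerD2r.
  apply: le_trans (prob_setU_le m3 mXY) _; rewrite lerD2r.
  apply: le_trans (prob_setU_le m2 mYX) _; rewrite lerD2r.
  exact: prob_setU_le.
apply: le_prob.
- exact: (@measurable_gt (X \+ Y)) (measurable_realfun.measurable_funD _ _).
- exact: measurableU.
move=> w /= xXY.
have [?|Xe] := ltP (x - e) (X w); first by do 4 left.
have [?|Ye] := ltP (x - e) (Y w); first by do 3 left; right.
have eY : e < Y w by lra.
have eX : e < X w by lra.
have [?|Xl] := ltP (x - l) (X w).
  by left; left; right; split => //; exact: lt_le_trans (ler_norm _).
have [?|Yl] := ltP (x - l) (Y w).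
  by left; right; split => //; exact: lt_le_trans (ler_norm _).
by right; split; lra.
Qed.

Lemma prob_sum_gt_ge (X Y : {RV P >-> R}) (x e : R) : 0 <= x ->
  prob P [set w | x + e < X w] + prob P [set w | x + e < Y w]
    - prob P ([set w | e < `|Y w|] `&` [set w | x + e < X w])
    - prob P ([set w | e < `|X w|] `&` [set w | x + e < Y w])
  <= prob P [set w | x < X w + Y w].
Proof.
move=> x0.
have mX a := measurable_gt a (measurable_funPT X).
have mY a := measurable_gt a (measurable_funPT Y).
have mnX := measurable_norm_gt e (measurable_funPT X).
have mnY := measurable_norm_gt e (measurable_funPT Y).
(* Each marginal term minus its cross term is the probability of a set difference: one variable
   above [x + e], the other at most [e] in absolute value. *)
rewrite (_ : forall a b c d : R, a + b - c - d = (a - c) + (b - d)); last first.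
  by move=> *; ring.
rewrite -!prob_setD// -prob_setU; [|exact: measurableD|exact: measurableD|].
  apply: le_prob.
  - by apply: measurableU; exact: measurableD.
  - exact: (@measurable_gt (X \+ Y)) (measurable_realfun.measurable_funD _ _).
  move=> w /= [[xX /negP]|[xY /negP]]; rewrite -leNgt ler_norml => /andP[? ?]; lra.
(* Disjointness is where [0 <= x] enters: [X w > x + e >= e] contradicts [|X w| <= e]. *)
apply/seteqP; split => // w /= [[xX _] [_ /negP]].
by rewrite -leNgt ler_norml => /andP[? ?]; lra.
Qed.

(* The hypothesis on W given Z > u is used at the shifted point
   u = x + s f(x), where f(u) < 2 f(x) eventually. *)
Lemma cross_prob_negligible (X Z W : {RV P >-> R}) (f : R -> R) (c s e : R) :
    right_endpoint (distr_fun X) = +oo%E ->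
    (\forall x \near +oo, 0 < f x) ->
    x + s * f x @[x --> +oo] --> +oo ->
    f (x + s * f x) / f x @[x --> +oo] --> (1 : R) ->
    tail (distr_fun X) (x + s * f x) / tail (distr_fun X) x @[x --> +oo]
      --> expR (- s) ->
    tail (distr_fun Z) x / tail (distr_fun X) x @[x --> +oo] --> c ->
    (forall t : R, 0 < t ->
      cond_prob P [set w | t * f x < `|W w|] [set w | x < Z w]
        @[x --> +oo] --> (0 : R)) ->
    0 < e ->
  prob P ([set w | e * f x < `|W w|] `&` [set w | x + s * f x < Z w])
    / tail (distr_fun X) x @[x --> +oo] --> (0 : R).
Proof.
move=> Xoo f0 uoo fu pu qp WZ e0.
have p0 x := tail_distr_gt0 x Xoo.
have mZ a := measurable_gt a (measurable_funPT Z).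
have mW a := measurable_norm_gt a (measurable_funPT W).
have e20 : 0 < e / 2 by rewrite divr_gt0.
pose u x := x + s * f x.
(* The three factors tend to 0, [c] and [expR (- s)]. The threshold is halved so that
   [e / 2 * f (u x)] eventually lies below [e * f x]. *)
pose b x := cond_prob P [set w | e / 2 * f (u x) < `|W w|] [set w | u x < Z w]
  * (tail (distr_fun Z) (u x) / tail (distr_fun X) (u x))
  * (tail (distr_fun X) (u x) / tail (distr_fun X) x).
have b0 : b x @[x --> +oo] --> (0 : R).
  rewrite -(mul0r (expR (- s))) -(mul0r c); apply: cvgM => //; apply: cvgM.
    exact: (cvg_comp _ _ uoo (WZ _ e20)).
  exact: (cvg_comp _ _ uoo qp).
apply: squeeze_cvgr (cvg_cst 0) b0.
near=> x.
have fx : 0 < f x by near: x.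
have fu2 : f (u x) / f x < 2 by near: x; apply: (cvgr_lt _ fu); rewrite ltr1n.
have -> : b x = prob P ([set w | e / 2 * f (u x) < `|W w|]
    `&` [set w | u x < Z w]) / tail (distr_fun X) x.
  by rewrite -cond_probM// prob_gt /b mulrA mulrA divfK ?gt_eqF//.
rewrite divr_ge0 ?prob_ge0 ?(ltW (p0 _))//= ler_pM2r ?invr_gt0//.
apply: le_prob; [exact: measurableI|exact: measurableI|].
move=> w /= [eW uZ]; split=> //; apply: le_lt_trans eW.
by rewrite ltr_pdivrMr// in fu2; rewrite -/(u x) in fu2; nra.
Unshelve. all: by end_near. Qed.

(* The tail at x + s f(x) is comparable to the tail at x, hence tends to 0;
   for s < 0 this avoids deriving f(x) = o(x) from f' -> 0. *)
Lemma cvg_shift (X : {RV P >-> R}) (f : R -> R) (s : R) :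
    right_endpoint (distr_fun X) = +oo%E ->
    distr_fun X x @[x --> +oo] --> (1 : R) ->
    tail (distr_fun X) (x + s * f x) / tail (distr_fun X) x @[x --> +oo]
      --> expR (- s) ->
  x + s * f x @[x --> +oo] --> +oo.
Proof.
move=> Xoo F1 pu.
have p0 x := tail_distr_gt0 x Xoo.
have pto0 : tail (distr_fun X) x @[x --> +oo] --> (0 : R).
  by rewrite -(subrr 1); apply: cvgB => //; exact: cvg_cst.
apply: (cvgy_of_cvg0 (u := fun x => x + s * f x) p0 (@tail_distr_noninc X)).
rewrite -(mulr0 (expR (- s))).
apply: (cvg_trans _ (cvgM pu pto0)); apply: near_eq_cvg.
by near=> x; rewrite /= divfK// gt_eqF.
Unshelve. all: by end_near. Qed.
End tail_probabilities.

Theorem theorem2p1 (R : realType) (d : measure_display) (T : measurableType d)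
    (P : probability T R) (X Y : {RV P >-> R}) (f : R -> R) (c : R)
    (h_endpoint : right_endpoint (distr_fun X) = +oo%E)
    (h_mda : MDA_gumbel (distr_fun X))
    (h_aux : auxiliary_function (distr_fun X) f)
    (c_ge0 : 0 <= c)
    (h_tails : tail (distr_fun Y) x / tail (distr_fun X) x @[x --> +oo] --> c)
    (h_YX : forall t : R, 0 < t ->
      cond_prob P [set w | t * f x < `|Y w|] [set w | x < X w]
        @[x --> +oo] --> (0 : R))
    (h_XY : forall t : R, 0 < t ->
      cond_prob P [set w | t * f x < `|X w|] [set w | x < Y w]
        @[x --> +oo] --> (0 : R))
    (h_joint : exists2 L : R, 0 < L &
      prob P [set w | L * f x < Y w /\ L * f x < X w] / prob P [set w | x < X w]
        @[x --> +oo] --> (0 : R)) :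
  prob P [set w | x < X w + Y w] / prob P [set w | x < X w]
    @[x --> +oo] --> 1 + c.
Proof.
have [f0 _ _ fsn pexp] := h_aux.
have [[_ _ _ F1] _] := h_mda.
have [L L0 jointL] := h_joint.
set p := tail (distr_fun X) in pexp h_tails *.
set q := tail (distr_fun Y) in h_tails *.
have p0 x : 0 < p x := tail_distr_gt0 x h_endpoint.
have uoo s : x + s * f x @[x --> +oo] --> +oo.
  exact: cvg_shift h_endpoint F1 (pexp s).
(* With [u = x + s * f x], split [q u / p x] as [q u / p u] times [p u / p x]. *)
have qp s : q (x + s * f x) / p x @[x --> +oo] --> c * expR (- s).
  apply: (cvg_trans _ (cvgM (cvg_comp _ _ (uoo s) h_tails) (pexp s))).
  apply: near_eq_cvg; near=> x.
  by rewrite /= mulrA divfK// gt_eqF.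
(* The tail-ratio hypothesis of [cross_prob_negligible] for [Z] equal to [X]. *)
have pp : p x / p x @[x --> +oo] --> (1 : R).
  under eq_fun do rewrite divff ?gt_eqF//.
  exact: cvg_cst.
have negX s e (e0 : 0 < e) := cross_prob_negligible h_endpoint f0 (uoo s)
  (fsn s) (pexp s) pp h_YX e0.
have negY s e (e0 : 0 < e) := cross_prob_negligible h_endpoint f0 (uoo s)
  (fsn s) (pexp s) h_tails h_XY e0.
(* The target is the value at 0 of the limit that the bounds have as a function of the shift [s]. *)
rewrite (_ : 1 + c = (1 + c) * expR (- 0)); last by rewrite oppr0 expR0 mulr1.
apply: (cvg_sandwich (k := fun s => (1 + c) * expR (- s))).
  apply: cvgM; first exact: cvg_cst.
  by apply: continuous_comp; [exact: oppr_continuous|exact: continuous_expR].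
move=> s s0.
pose cX e r x := prob P ([set w | e * f x < `|Y w|] `&` [set w | x + r * f x < X w]).
pose cY e r x := prob P ([set w | e * f x < `|X w|] `&` [set w | x + r * f x < Y w]).
exists (fun x => p (x + s * f x) / p x + q (x + s * f x) / p x
  - cX s s x / p x - cY s s x / p x).
(* Two scales occur: [s] is the small shift and the threshold of the cross events, while their base
   level uses the fixed shift [- L], so that the leftover event is exactly the one in [jointL]. *)
exists (fun x => p (x + - s * f x) / p x + q (x + - s * f x) / p x
  + cX s (- L) x / p x + cY s (- L) x / p x
  + prob P [set w | L * f x < Y w /\ L * f x < X w] / prob P [set w | x < X w]).
split.
- near=> x; rewrite prob_gt -!mulrDl -!mulNr -!mulrDl !ler_pM2r ?invr_gt0//.
  apply/andP; split.
    by rewrite /p /q -!prob_gt; apply: prob_sum_gt_ge; near: x; exact: nbhs_pinfty_ge.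
  by rewrite /cX /cY /p /q -!prob_gt !mulNr; exact: prob_sum_gt_le.
- have -> : (1 + c) * expR (- s) = expR (- s) + c * expR (- s) - 0 - 0 by ring.
  apply: cvgB; last exact: negY.
  apply: cvgB; last exact: negX.
  by apply: cvgD => //; exact: pexp.
- have -> : (1 + c) * expR (- - s) = expR (- - s) + c * expR (- - s) + 0 + 0 + 0 by ring.
  apply: cvgD => //; apply: cvgD; last exact: negY.
  apply: cvgD; last exact: negX.
  by apply: cvgD => //; exact: pexp.
Unshelve. all: by end_near. Qed.
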